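(* Let $D$ be any infinite digraph. The map $\lambda \mapsto f_{\lambda}$ with domain $\Lambda(D)$ is a bijection between the set $\Lambda(D)$ of limit edges of $D$ and the set of edge-directions of $D$.
   Context: Digraphs have no loops and no parallel edges, but may contain both edges $uv$ and $vu$. For a digraph $D$, $\mathcal{X}(D)$ denotes the set of finite subsets of $V(D)$; for $A,B\subseteq V(D)$, $E(A,B)$ is the set of edges of $D$ from $A$ to $B$. A (directed) ray is a digraph on distinct vertices $v_0,v_1,\dots$ with edges $v_iv_{i+1}$; its tails are its subrays. A ray $R\subseteq D$ is solid in $D$ if for every $X\in\mathcal{X}(D)$ some tail of $R$ lies in a single strong component of $D-X$. Two solid rays are equivalent if for every $X\in\mathcal{X}(D)$ they have tails in the same strong component of $D-X$; the equivalence classes are the ends of $D$. For an end $\omega$ and $X\in\mathcal{X}(D)$, $C(X,\omega)$ is the strong component of $D-X$ containing a tail of every ray in $\omega$; $X$ separates ends $\omega,\eta$ if $C(X,\omega)\ne C(X,\eta)$. Limit edges: for distinct ends $\omega,\eta$, the pair $\omega\eta$ is a limit edge if $D$ has an edge from $C(X,\omega)$ to $C(X,\eta)$ for every $X\in\mathcal{X}(D)$ separating $\omega$ and $\eta$. For a vertex $v$ and an end $\omega$, $v\omega$ is a limit edge if $D$ has an edge from $v$ to $C(X,\omega)$ for every $X\in\mathcal{X}(D)$ with $v\notin C(X,\omega)$; and $\omega v$ is a limit edge if $D$ has an edge from $C(X,\omega)$ to $v$ for every $X\in\mathcal{X}(D)$ with $v\notin C(X,\omega)$. $\Lambda(D)$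 is the set of limit edges. Bundles: for $X\in\mathcal{X}(D)$, a bundle of $D-X$ is a non-empty edge set of the form $E(C,C')$, $E(v,C)$ or $E(C,v)$ where $C,C'$ are distinct strong components of $D-X$ and $v\in X$. A direction of $D$ is a map $f$ with domain $\mathcal{X}(D)$ sending each $X$ to a strong component or to a bundle of $D-X$ such that $f(X)\supseteq f(Y)$ whenever $X\subseteq Y$ (where, when comparing, a strong component is identified with its set of edges). A direction is an edge-direction if $f(X)$ is a bundle for some $X\in\mathcal{X}(D)$. For a limit edge $\lambda$, $f_\lambda$ is defined as follows. If $\lambda=\omega\eta$: $f_\lambda(X)=E(C(X,\omega),C(X,\eta))$ if $X$ separates $\omega,\eta$, and $f_\lambda(X)=C(X,\omega)=C(X,\eta)$ otherwise. If $\lambda=v\omega$ (resp. $\omega v$): if $v\in C(X,\omega)$ then $f_\lambda(X)=C(X,\omega)$; if $v\in X$ then $f_\lambda(X)=E(v,C(X,\omega))$ (resp. $E(C(X,\omega),v)$); if $v$ lies in a strong component $C'\neq C(X,\omega)$ of $D-X$ then $f_\lambda(X)=E(C',C(X,\omega))$ (resp. $E(C(X,\omega),C')$).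
   Formalization: In f(X) ⊇ f(Y), strong components are compared as subgraphs (vertex sets as well as edge sets), so a one-vertex component never lies in a bundle; with edge sets alone the claim fails, e.g. for infinitely many vertices and a single edge. *)

(* Defs.v *)
From Stdlib Require Import Relation_Operators.
From HB Require Import structures.
From mathcomp Require Import all_boot finmap.
From mathcomp Require Import boolp classical_sets functions cardinality.

Set Implicit Arguments.
Unset Strict Implicit.
Unset Printing Implicit Defensive.

Local Open Scope classical_set_scope.

Record digraph := Digraph {
  vertex :> choiceType;
  edges : set (vertex * vertex);
  edges_irrefl : forall v : vertex, ~ edges (v, v)
}.
Arguments edges : clear implicits.

Section Digraph.
Variable D : digraph.
Implicit Types (X Y : {fset D}) (A B C : set D) (v : D) (R : nat -> D)
  (w h : set (nat -> D)).

Definition edges_between A B : set (D * D) := edges D `&` (A `*` B).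

Definition connected_in A : D -> D -> Prop :=
  clos_refl_trans D (fun u v => edges_between A A (u, v)).

Definition strongly_connected A :=
  A !=set0 /\ forall u v, A u -> A v -> connected_in A u v.

(* A maximal strongly connected subgraph is induced, so strong components of
   D - X are represented by their vertex sets. *)
Definition strong_component X C :=
  [/\ C `<=` ~` [set` X], strongly_connected C
    & forall B, C `<=` B -> B `<=` ~` [set` X] -> strongly_connected B ->
      B = C].

(* A ray is given by its sequence of vertices. *)
Definition ray R := injective R /\ forall n, edges D (R n, R n.+1).

Definition has_tail_in R C := exists n, forall m, n <= m -> C (R m).

Definition solid R :=
  ray R /\ forall X, exists2 C, strong_component X C & has_tail_in R C.

Definition ray_equiv R R' :=
  forall X, exists C,
    [/\ strong_component X C, has_tail_in R C & has_tail_in R' C].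

Definition is_end w :=
  exists2 R, solid R & w = [set R' | solid R' /\ ray_equiv R R'].

(* C(X, w); the default value set0 is not used when w is an end, see
   comp_endP. *)
Definition comp_end X w : set D :=
  xget set0 [set C | strong_component X C /\
                     forall R, w R -> has_tail_in R C].

(* The strong component of D - X containing v; the default value set0 is not
   used when v lies outside X, see comp_vertexP. *)
Definition comp_vertex X v : set D :=
  xget set0 [set C | strong_component X C /\ C v].

Inductive limit_pair :=
  | EndEnd of set (nat -> D) & set (nat -> D)
  | VertexEnd of D & set (nat -> D)
  | EndVertex of set (nat -> D) & D.

Definition limit_edge : set limit_pair := [set l |
  match l with
  | EndEnd w h =>
      [/\ is_end w, is_end h, w <> h
        & forall X, comp_end X w <> comp_end X h ->
          edges_between (comp_end X w) (comp_end X h) !=set0]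
  | VertexEnd v w =>
      is_end w /\
      forall X, ~ comp_end X w v ->
        edges_between [set v] (comp_end X w) !=set0
  | EndVertex w v =>
      is_end w /\
      forall X, ~ comp_end X w v ->
        edges_between (comp_end X w) [set v] !=set0
  end].

Definition bundle X (F : set (D * D)) :=
  F !=set0 /\
  [\/ exists C C', [/\ strong_component X C, strong_component X C', C <> C'
                     & F = edges_between C C'],
      exists v C, [/\ v \in X, strong_component X C
                    & F = edges_between [set v] C]
    | exists v C, [/\ v \in X, strong_component X C
                    & F = edges_between C [set v]]].

Inductive part :=
  | Component of set D
  | Bundle of set (D * D).

Definition part_of X (p : part) :=
  match p with
  | Component C => strong_component X C
  | Bundle F => bundle X F
  end.

Definition part_vertices (p : part) : set D :=
  match p with Component C => C | Bundle _ => set0 end.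

Definition part_edges (p : part) : set (D * D) :=
  match p with Component C => edges_between C C | Bundle F => F end.

(* Inclusion of edge sets alone would let a one-vertex component, which has no
   edges, lie inside every bundle and every component.  The vertex condition
   excludes exactly this; it is void when p is a bundle. *)
Definition part_sub (p q : part) :=
  part_vertices p `<=` part_vertices q /\ part_edges p `<=` part_edges q.

Definition direction (f : {fset D} -> part) :=
  (forall X, part_of X (f X)) /\
  (forall X Y, (X `<=` Y)%fset -> part_sub (f Y) (f X)).

Definition edge_direction : set ({fset D} -> part) :=
  [set f | direction f /\ exists X F, f X = Bundle F].

Definition limit_edge_direction (l : limit_pair) X : part :=
  match l with
  | EndEnd w h =>
      if `[< comp_end X w = comp_end X h >] then Component (comp_end X w)
      else Bundle (edges_between (comp_end X w) (comp_end X h))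
  | VertexEnd v w =>
      if `[< comp_end X w v >] then Component (comp_end X w)
      else if v \in X then Bundle (edges_between [set v] (comp_end X w))
      else Bundle (edges_between (comp_vertex X v) (comp_end X w))
  | EndVertex w v =>
      if `[< comp_end X w v >] then Component (comp_end X w)
      else if v \in X then Bundle (edges_between (comp_end X w) [set v])
      else Bundle (edges_between (comp_end X w) (comp_vertex X v))
  end.

Lemma connected_inS A B u v :
  A `<=` B -> connected_in A u v -> connected_in B u v.
Proof.
move=> AB; elim=> [x y [exy [Ax Ay]]|x|x y z _ xy _ yz].
- by apply: rt_step; split=> //; split; apply: AB.
- exact: rt_refl.
- exact: rt_trans xy yz.
Qed.

Lemma strongly_connectedU A B v : strongly_connected A ->
  strongly_connected B -> A v -> B v -> strongly_connected (A `|` B).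
Proof.
move=> [_ cA] [_ cB] Av Bv; split; first by exists v; left.
have to_v u : (A `|` B) u ->
    connected_in (A `|` B) u v /\ connected_in (A `|` B) v u.
  case=> [Au|Bu]; split.
  - exact: connected_inS (@subsetUl _ A B) (cA _ _ Au Av).
  - exact: connected_inS (@subsetUl _ A B) (cA _ _ Av Au).
  - exact: connected_inS (@subsetUr _ A B) (cB _ _ Bu Bv).
  - exact: connected_inS (@subsetUr _ A B) (cB _ _ Bv Bu).
by move=> x y /to_v[xv _] /to_v[_ vy]; apply: rt_trans xv vy.
Qed.

Lemma strong_component_uniq X C C' v : strong_component X C ->
  strong_component X C' -> C v -> C' v -> C = C'.
Proof.
move=> [CX cC mC] [CX' cC' mC'] Cv C'v.
have cU := strongly_connectedU cC cC' Cv C'v.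
have UX : C `|` C' `<=` ~` [set` X] by move=> x [/CX|/CX'].
have <- := mC _ (@subsetUl _ C C') UX cU.
exact: mC' _ (@subsetUr _ C C') UX cU.
Qed.

Lemma comp_endP X w : is_end w -> strong_component X (comp_end X w) /\
  forall R, w R -> has_tail_in R (comp_end X w).
Proof.
move=> [R [_ solR] ->].
apply: (@xgetPex _ set0
  [set C | strong_component X C /\ forall R', _ -> has_tail_in R' C]).
have [C cC [n RC]] := solR X; exists C; split=> // R' [_ /(_ X)].
move=> [C' [cC' [n' R'C'] tC']].
suff -> : C = C' by [].
by apply: (strong_component_uniq (v := R (maxn n n')) cC cC');
  [apply: RC; rewrite leq_maxl | apply: R'C'; rewrite leq_maxr].
Qed.

Lemma comp_vertexP X v : v \notin X ->
  strong_component X (comp_vertex X v) /\ comp_vertex X v v.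
Proof.
move=> vX; apply: (@xgetPex _ set0 [set C | strong_component X C /\ C v]).
pose C := \bigcup_(B in [set B | [/\ B `<=` ~` [set` X],
  strongly_connected B & B v]]) B.
have Cv : C v.
  exists [set v] => //; split=> //.
    by move=> _ -> /=; apply/negP.
  by split; [exists v | move=> _ _ -> ->; apply: rt_refl].
exists C; split=> //; split.
- by move=> x [B [BX _ _] /BX].
- split; first by exists v.
  move=> x y [B hB Bx] [B' hB' B'y]; apply: (@rt_trans _ _ _ v).
    by have [_ [_ cB] Bv] := hB; apply: connected_inS (cB _ _ Bx Bv) => z Bz;
      exists B.
  by have [_ [_ cB] Bv] := hB'; apply: connected_inS (cB _ _ Bv B'y) => z Bz;
    exists B'.
- move=> B CB BX cB; apply/seteqP; split=> // x Bx.
  by exists B => //; split=> //; apply: CB.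
Qed.

End Digraph.

(* Main.v *)
(** A finite set X partitions the vertices of D into blocks: the singletons of
    X and the strong components of D - X.  A direction picks at every X an
    ordered pair of blocks, a component being the pair of twice the same block,
    and the edges of a bundle determine its two blocks.  So a direction is a
    pair of maps choosing blocks that shrink as X grows, and an edge-direction
    is the direction of a limit edge as soon as each such map is given by a
    vertex or by an end.  If some block chosen is a singleton {v} with v in X,
    the map is given by v.  Otherwise it is a map g choosing strong components,
    and a ray with a tail in every g X is needed.

    Call a finite set Z escapable if for each finite S included in g Z there is
    a finite Y including Z and disjoint from S such that g Y misses S.  If some
    Z is escapable, one finds sets Y n including Z and pairwise disjoint within
    g Z such that every vertex lies in only finitely many g (Y n); then g (Y n)
    is included in g X for large n.  If no Z is escapable, one finds pairwise
    disjoint finite strongly connected sets T n, each meeting g X for large n,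
    hence lying in g X for large n.  Both cases give a sequence of vertices that
    is eventually in each g X; linking its members by finite strongly connected
    sets that leave every finite set gives the ray. *)

From Stdlib Require Import Relation_Operators Operators_Properties.
Require Import Defs.
From mathcomp Require Import all_boot finmap.
From mathcomp Require Import boolp classical_sets functions cardinality.

Set Implicit Arguments.
Unset Strict Implicit.
Unset Printing Implicit Defensive.

Local Open Scope classical_set_scope.

(** * Properties that hold from some index on *)

Definition eventually (P : nat -> Prop) :=
  exists N, forall n, N <= n -> P n.

Lemma eventually_impl (P Q : nat -> Prop) :
  (forall n, P n -> Q n) -> eventually P -> eventually Q.
Proof. by move=> PQ [N PN]; exists N => n /PN /PQ. Qed.

Lemma eventually_and (P Q : nat -> Prop) :
  eventually P -> eventually Q -> eventually (fun n => P n /\ Q n).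
Proof.
move=> [N PN] [M QM]; exists (maxn N M) => n; rewrite geq_max => /andP[Nn Mn].
by split; [apply: PN | apply: QM].
Qed.

Lemma eventually_ge m : eventually (fun n => m <= n).
Proof. by exists m. Qed.

Lemma eventually_fset {T : choiceType} (X : {fset T}) (P : T -> nat -> Prop) :
  (forall x, x \in X -> eventually (P x)) ->
  eventually (fun n => forall x, x \in X -> P x n).
Proof.
move=> evP; suff: forall s : seq T, {subset s <= X} ->
    eventually (fun n => forall x, x \in s -> P x n).
  by move=> /(_ (enum_fset X)); apply.
elim=> [|a s IHs] sX; first by exists 0.
have aP : eventually (P a) by apply: evP; apply: sX; rewrite mem_head.
have sP : eventually (fun n => forall x, x \in s -> P x n).
  by apply: IHs => x xs; apply: sX; rewrite inE xs orbT.
apply: eventually_impl (eventually_and aP sP) => n [Pa Ps] x.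
by rewrite inE => /orP[/eqP->|/Ps].
Qed.

(** Serves to show that a vertex lies in only finitely many sets of a sequence in which every vertex
    met is avoided later on. *)
Lemma eventually_not (P : nat -> Prop) :
  (forall m, P m -> eventually (fun n => ~ P n)) ->
  eventually (fun n => ~ P n).
Proof.
move=> Pev; have [[m /Pev]//|nP] := pselect (exists m, P m).
by exists 0 => n _ Pn; apply: nP; exists n.
Qed.

(** * Finite strongly connected sets *)

Section StrongSets.
Variable D : digraph.
Implicit Types (X Y Z S T : {fset D}) (A B C : set D) (u v x : D).

Lemma strong_component_neq0 X C : strong_component X C -> C !=set0.
Proof. by move=> [_ []]. Qed.

Lemma strong_component_notin X C v : strong_component X C -> C v -> v \notin X.
Proof. by move=> [CX _ _] /CX /= /negP. Qed.

(** [C] and [A] share [v], so their union is strongly connected and, by maximality, equal to [C]. *)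
Lemma strongly_connected_sub_component X A C v :
  strong_component X C -> strongly_connected A ->
  (forall x, A x -> x \notin X) -> A v -> C v -> A `<=` C.
Proof.
move=> [CX cC mC] cA AX Av Cv.
have <- := mC (C `|` A); first exact: subsetUr.
- exact: subsetUl.
- by move=> x [/CX//|/AX /negP].
- exact: strongly_connectedU cC cA Cv Av.
Qed.

(** [T] is the vertex set of a walk from [u] to [v]; the induction appends a last vertex [z]. *)
Lemma connected_in_fset A u v : connected_in A u v -> A u ->
  exists T, [/\ [set` T] `<=` A, u \in T, v \in T &
    forall x, x \in T -> connected_in [set` T] u x /\
                         connected_in [set` T] x v].
Proof.
move=> cuv Au.
elim/(@clos_refl_trans_ind_left): cuv 
  => [|y z uy [T [TA uT yT cT]] [yz [Ay Az]]].
  exists [fset u]%fset; split; rewrite ?inE //.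
    by move=> x /=; rewrite inE => /eqP->.
  by move=> x; rewrite inE => /eqP->; split; apply: rt_refl.
have TT : [set` T] `<=` [set` (z |` T)%fset].
  by move=> x /= xT; rewrite !inE xT orbT.
have cyz : connected_in [set` (z |` T)%fset] y z.
  by apply: rt_step; split=> //; split=> /=; rewrite !inE ?eqxx// yT orbT.
exists (z |` T)%fset; split; rewrite ?inE ?eqxx ?uT ?orbT //.
  by move=> x /=; rewrite !inE => /orP[/eqP->|/TA].
move=> x; rewrite !inE => /orP[/eqP->|/cT[ux xy]]; split.
- by apply: rt_trans cyz; apply: connected_inS TT _; case: (cT y yT).
- exact: rt_refl.
- exact: connected_inS TT ux.
- by apply: rt_trans cyz; apply: connected_inS TT xy.
Qed.

(** A walk from [u] to [v] and one back form a closed walk, whose vertex set is finite and strongly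
    connected. *)
Lemma strongly_connected_fset2 A u v : strongly_connected A -> A u -> A v ->
  exists T, [/\ strongly_connected [set` T], [set` T] `<=` A,
                u \in T & v \in T].
Proof.
move=> [_ cA] Au Av.
have [T [TA uT vT cT]] := connected_in_fset (cA _ _ Au Av) Au.
have [S [SA vS uS cS]] := connected_in_fset (cA _ _ Av Au) Av.
have TTS : [set` T] `<=` [set` (T `|` S)%fset].
  by move=> x /= xT; rewrite inE xT.
have STS : [set` S] `<=` [set` (T `|` S)%fset].
  by move=> x /= xS; rewrite inE xS orbT.
exists (T `|` S)%fset; split; rewrite ?inE ?uT ?vT //; last first.
  by move=> x /=; rewrite inE => /orP[/TA|/SA].
have uv : connected_in [set` (T `|` S)%fset] u v.
  by apply: connected_inS TTS (proj1 (cT _ vT)).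
have vu : connected_in [set` (T `|` S)%fset] v u.
  by apply: connected_inS STS (proj1 (cS _ uS)).
have cu x : x \in (T `|` S)%fset -> connected_in [set` (T `|` S)%fset] u x /\
    connected_in [set` (T `|` S)%fset] x u.
  rewrite inE => /orP[/cT[ux xv]|/cS[vx xu]]; split.
  - exact: connected_inS TTS ux.
  - by apply: rt_trans vu; apply: connected_inS TTS xv.
  - by apply: rt_trans uv _; apply: connected_inS STS vx.
  - exact: connected_inS STS xu.
split; first by exists u => /=; rewrite inE uT.
by move=> x y /cu[_ xu] /cu[uy _]; apply: rt_trans xu uy.
Qed.

(** Each vertex of [S] is joined to one base vertex [u] by a finite strong set, and strong sets
    sharing [u] have a strong union. *)
Lemma strongly_connected_fset A S : strongly_connected A ->
  [set` S] `<=` A -> exists T,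
  [/\ strongly_connected [set` T], [set` T] `<=` A & {subset S <= T}].
Proof.
move=> cA SA; have [[u Au] _] := cA.
suff: forall s : seq D, {subset s <= S} -> exists T,
    [/\ strongly_connected [set` T], [set` T] `<=` A, u \in T
      & {subset s <= T}].
  by move=> /(_ (enum_fset S))[//|T [cT TA _ ST]]; exists T.
elim=> [|a s IHs] sS.
  by have [T [cT TA uT _]] := strongly_connected_fset2 cA Au Au; exists T.
have [|T [cT TA uT sT]] := IHs.
  by move=> x xs; apply: sS; rewrite inE xs orbT.
have Aa : A a by apply: SA; apply: sS; rewrite mem_head.
have [T' [cT' TA' uT' aT']] := strongly_connected_fset2 cA Au Aa.
exists (T `|` T')%fset; split.
- have -> : [set` (T `|` T')%fset] = [set` T] `|` [set` T'].
    apply/seteqP; split=> x /=; first by rewrite inE => /orP.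
    by rewrite inE => xTT'; apply/orP.
  exact: strongly_connectedU cT cT' uT uT'.
- by move=> x /=; rewrite inE => /orP[/TA|/TA'].
- by rewrite inE uT.
- by move=> x; rewrite !inE => /orP[/eqP->|/sT->//]; rewrite aT' orbT.
Qed.

End StrongSets.

(** * Rays from walks and from chains of strong sets *)

Section Rays.
Variable D : digraph.

Lemma connected_in_path (A : set D) (u v : D) : connected_in A u v -> A u ->
  exists p, [/\ path (fun x y => `[< edges D (x, y) >]) u p, last u p = v
    & forall x, x \in u :: p -> A x].
Proof.
move=> cuv; elim: (clos_rt_rt1n _ _ _ _ cuv) => [x|x y z [xy [Ax Ay]] _ IH] Au.
  by exists [::]; split=> // y; rewrite inE => /eqP->.
have [p [yp <- pA]] := IH Ay; exists (y :: p); split=> //=.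
  by rewrite yp andbT; apply/asboolP.
by move=> w; rewrite inE => /orP[/eqP->|/pA].
Qed.

(* The ray leaves every vertex of the walk after its last visit, so the
   stuttering steps of the walk are skipped. *)
Lemma ray_of_walk (w : nat -> D) :
  (forall n, w n = w n.+1 \/ edges D (w n, w n.+1)) ->
  (forall v, eventually (fun n => w n <> v)) ->
  exists R, ray R /\ forall C, has_tail_in w C -> has_tail_in R C.
Proof.
move=> w_step w_fin.
have last_visit i : exists j, [/\ i <= j, w j = w i
    & forall m, j < m -> w m <> w i].
  have [N wN] := w_fin (w i).
  have exj : exists j, (i <= j) && (w j == w i) by exists i; rewrite leqnn /=.
  have bndj j : (i <= j) && (w j == w i) -> j <= N.
    move=> /andP[_ /eqP wj]; rewrite leqNgt; apply/negP => /ltnW Nj.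
    exact: wN Nj wj.
  case: (ex_maxnP exj bndj) => j /andP[ij /eqP wj] jmax.
  exists j; split=> // m jm wm; move: (jm); rewrite ltnNge => /negP; apply.
  by apply: jmax; rewrite (leq_trans ij (ltnW jm)) /= wm.
have [lst lstP] := choice last_visit.
pose idx := fix idx k := if k is k'.+1 then lst (idx k').+1 else lst 0.
have idx_last k m : idx k < m -> w m <> w (idx k).
  have [i ->] : exists i, idx k = lst i.
    by case: k => [|k]; [exists 0 | exists (idx k).+1].
  by have [_ wi lm] := lstP i; rewrite wi; apply: lm.
have idxS k : idx k < idx k.+1 by have [] := lstP (idx k).+1.
have idx_mono : {homo idx : k l / k < l}.
  by apply: homo_ltn => // y x z; apply: ltn_trans.
have idx_ge k : k <= idx k by elim: k => // k IH; apply: leq_ltn_trans IH _.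
exists (w \o idx); split; last first.
  by move=> C [N wN]; exists N => k Nk; apply: wN; apply: leq_trans (idx_ge k).
split=> [k l /= wkl|k /=].
  case: (ltngtP k l) => // /idx_mono /idx_last.
    by move/(_ (esym wkl)).
  by move/(_ wkl).
have [_ -> _] := lstP (idx k).+1.
(* [idx k] is a last visit, so the step after it cannot stutter. *)
by case: (w_step (idx k)) => // /esym /(idx_last _ _ (ltnSn _)).
Qed.

(** Paths from [s k] to [s k.+1] inside [P k] concatenate to a walk that visits each vertex finitely
    often. *)
Lemma ray_of_chain (P : nat -> {fset D}) (s : nat -> D) :
  (forall k, strongly_connected [set` P k]) ->
  (forall k, s k \in P k) -> (forall k, s k.+1 \in P k) ->
  (forall v, eventually (fun k => v \notin P k)) ->
  exists R, ray R /\
    forall C, eventually (fun k => [set` P k] `<=` C) -> has_tail_in R C.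
Proof.
move=> cP sP sSP P_fin.
pose e := fun x y => `[< edges D (x, y) >].
have exq k : exists q, [/\ path e (s k) q, last (s k) q = s k.+1
    & forall x, x \in s k :: q -> x \in P k].
  by apply: connected_in_path; [apply: (proj2 (cP k)); [exact: sP|exact: sSP]
    |exact: sP].
have [q qP] := choice exq.
(* A state (k, x, p) is the vertex x with the rest p of a path to s k.+1. *)
pose step (c : nat * D * seq D) :=
  let: (k, x, p) := c in
  if p is y :: p' then (k, y, p') else (k.+1, x, q k.+1).
pose st i := iter i step (0, s 0, q 0).
pose inv (c : nat * D * seq D) := let: (k, x, p) := c in
  [/\ path e x p, last x p = s k.+1 & forall y, y \in x :: p -> y \in P k].
have invS c : inv c -> inv (step c).
  move: c => [[k x] [|y p]] /= [xp xl xP]; first by rewrite xl; apply: qP.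
  split=> //; first by case/andP: xp.
  by move=> z zp; apply: xP; rewrite inE zp orbT.
have inv_st i : inv (st i) by elim: i => [|i IH]; [apply: qP | apply: invS].
pose w i := (st i).1.2.
have stage_mono i j : i <= j -> (st i).1.1 <= (st j).1.1.
  move=> /subnKC <-; elim: (j - i) => [|m IH]; rewrite ?addn0 // addnS.
  apply: leq_trans IH _; rewrite [st _.+1]/= -/(st (i + m)).
  by case: (st _) => [[k x] [|y p]] /=.
have stage_grows i : exists j, (st j).1.1 = (st i).1.1.+1.
  case E : (st i) => [[k x] p] /=.
  elim: p i x E => [|y p IH] i x E; first by exists i.+1; rewrite /= -/(st i) E.
  by apply: (IH i.+1 y); rewrite /= -/(st i) E.
have stage_unbounded k : eventually (fun i => k <= (st i).1.1).
  suff [i ki] : exists i, k <= (st i).1.1.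
    by exists i => j /stage_mono; apply: leq_trans.
  elim: k => [|k [i ki]]; first by exists 0.
  by have [j ji] := stage_grows i; exists j; rewrite ji.
have wP i : w i \in P (st i).1.1.
  rewrite /w; have := inv_st i; case: (st i) => [[k x] p] /= [_ _]; apply.
  by rewrite mem_head.
have tail_w C : eventually (fun k => [set` P k] `<=` C) -> has_tail_in w C.
  move=> [N PC]; apply: eventually_impl (stage_unbounded N) => i Ni.
  exact: PC Ni _ (wP i).
have w_step n : w n = w n.+1 \/ edges D (w n, w n.+1).
  rewrite /w [st n.+1]/= -/(st n); have := inv_st n.
  (* An exhausted path only raises the stage; the walk stays in place. *)
  case: (st n) => [[k x] [|y p]] /= [xp _ _]; first by left.
  by right; case/andP: xp => /asboolP.
have w_fin v : eventually (fun n => w n <> v).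
  apply: (tail_w (fun x => x <> v)); apply: eventually_impl (P_fin v).
  by move=> k vk x xk xv; move: vk; rewrite -xv xk.
have [R [rR tR]] := ray_of_walk w_step w_fin.
by exists R; split=> // C /tail_w /tR.
Qed.

End Rays.

(** * Vertex-directions are induced by ends *)

Section VertexDirections.
Variables (D : digraph) (g : {fset D} -> set D).
Hypothesis g_component : forall X, strong_component X (g X).
Hypothesis g_anti : forall X Y, (X `<=` Y)%fset -> g Y `<=` g X.
Implicit Types X Y Z S T : {fset D}.

Lemma strongly_connected_sub_direction X (A : set D) v :
  strongly_connected A -> (forall x, A x -> x \notin X) ->
  A v -> g X v -> A `<=` g X.
Proof. exact: strongly_connected_sub_component. Qed.

Definition escapable Z := forall S, [set` S] `<=` g Z ->
  exists Y, (Z `<=` Y)%fset /\ forall x, x \in S -> x \notin Y /\ ~ g Y x.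

Lemma converging_sequence_escapable Z : escapable Z ->
  exists t : nat -> D, forall X, eventually (fun n => g X (t n)).
Proof.
move=> escZ.
have ex_y S : exists Y, [set` S] `<=` g Z ->
    (Z `<=` Y)%fset /\ forall x, x \in S -> x \notin Y /\ ~ g Y x.
  have [/escZ[Y YP]|nS] := pselect ([set` S] `<=` g Z); first by exists Y.
  (* A default value; the sets [H n] below all lie in [g Z]. *)
  by exists Z.
have [y yP] := choice ex_y.
have [u gu] := strong_component_neq0 (g_component Z).
(* [H n] collects [u] and the vertices of [g Z] in earlier sets [Y m]. Escaping it makes the [Y n]
   disjoint within [g Z] and keeps [u] out of [g (Y n)]. *)
pose H := fix H n := if n is m.+1
  then (H m `|` [fset x in y (H m) | `[< g Z x >]])%fset else [fset u]%fset.
pose Y n := y (H n).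
have HZ n : [set` H n] `<=` g Z.
  elim: n => [|n IH] x /=; first by rewrite inE => /eqP->.
  by rewrite !inE /= => /orP[/IH//|/andP[_ /asboolP]].
have H_mono m n : m <= n -> {subset H m <= H n}.
  move=> /subnKC <-; elim: (n - m) => [|k IH] x xm; rewrite ?addn0 ?addnS //=.
  by rewrite inE IH.
have YZ n : (Z `<=` Y n)%fset by case: (yP (H n) (HZ n)).
have YH n x : x \in H n -> x \notin Y n /\ ~ g (Y n) x.
  by case: (yP (H n) (HZ n)) => _; apply.
have uH n : u \in H n by apply: (H_mono 0 n) => //=; rewrite inE.
have Y_fin x : g Z x -> eventually (fun n => x \notin Y n).
  move=> gx; apply: eventually_impl (@eventually_not (fun n => x \in Y n) _).
    by move=> n /negP.
  move=> m xm; exists m.+1 => n mn; apply/negP.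
  apply: (proj1 (YH n x _)); apply: (H_mono _ _ mn) => /=.
  by rewrite !inE /= xm /= (asboolT gx) orbT.
(* A finite strong subgraph W of g Z through u and v would be swallowed by
   g (Y n) if it missed Y n, but u is not in g (Y n). *)
have g_fin v : eventually (fun n => ~ g (Y n) v).
  have [gv|ngv] := pselect (g Z v); last first.
    by exists 0 => n _ /(g_anti (YZ n)).
  have [_ cZ _] := g_component Z.
  have [W [cW WZ uW vW]] := strongly_connected_fset2 cZ gu gv.
  have : eventually (fun n => forall x, x \in W -> x \notin Y n).
    by apply: eventually_fset => x /WZ /Y_fin.
  apply: eventually_impl => n WY gnv; apply: (proj2 (YH n u (uH n))).
  exact: (strongly_connected_sub_direction (X := Y n) (v := v) cW WY vW gnv).
have [t tP] := choice (fun n => strong_component_neq0 (g_component (Y n))).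
exists t => X.
have : eventually (fun n => forall x, x \in X -> ~ g (Y n) x).
  by apply: eventually_fset => x _; apply: g_fin.
apply: eventually_impl => n Xn.
(* The component chosen at the union of [X] and [Y n] lies in both [g X] and [g (Y n)], so these
   meet. *)
have [v gv] := strong_component_neq0 (g_component (X `|` Y n)%fset).
have [_ cY _] := g_component (Y n).
apply: (strongly_connected_sub_direction (v := v) cY _ _ _ (tP n)).
- by move=> x gx; apply/negP => /Xn.
- exact: g_anti (fsubsetUr X (Y n)) _ gv.
- exact: g_anti (fsubsetUl X (Y n)) _ gv.
Qed.

Lemma converging_sequence_inescapable : (forall Z, ~ escapable Z) ->
  exists t : nat -> D, forall X, eventually (fun n => g X (t n)).
Proof.
move=> nesc.
(* Inescapability gives a finite [S] in [g Z] that meets [Y] or [g Y] for every [Y] including [Z];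
   [T] is a strong enlargement of it. *)
have ex_tr Z : exists T, [/\ strongly_connected [set` T], [set` T] `<=` g Z
    & forall Y, (Z `<=` Y)%fset -> exists x, x \in T /\ (x \in Y \/ g Y x)].
  have [S [SZ SP]] : exists S, [set` S] `<=` g Z /\ forall Y, (Z `<=` Y)%fset ->
      exists x, x \in S /\ (x \in Y \/ g Y x).
    apply: contrapT => nS; apply: (nesc Z) => S SZ.
    apply: contrapT => nY; apply: nS; exists S; split=> // Y ZY.
    apply: contrapT => nx; apply: nY; exists Y; split=> // x xS; split.
      by apply/negP => xY; apply: nx; exists x; split=> //; left.
    by move=> gx; apply: nx; exists x; split=> //; right.
  have [_ cZ _] := g_component Z.
  have [T [cT TZ ST]] := strongly_connected_fset cZ SZ.
  by exists T; split=> // Y /SP[x [/ST xT xP]]; exists x.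
have [tr trP] := choice ex_tr.
(* [H n] is the union of the earlier [T m]; as [T n] lies in [g (H n)], it is disjoint from them. *)
pose H := fix H n := if n is m.+1 then (H m `|` tr (H m))%fset else fset0.
pose T n := tr (H n).
have H_mono m n : m <= n -> {subset H m <= H n}.
  move=> /subnKC <-; elim: (n - m) => [|k IH] x xm; rewrite ?addn0 ?addnS //=.
  by rewrite inE IH.
have TH n x : x \in T n -> x \notin H n.
  have [_ TZ _] := trP (H n).
  by move=> /TZ; apply: strong_component_notin (g_component _).
have T_fin x : eventually (fun n => x \notin T n).
  apply: eventually_impl (@eventually_not (fun n => x \in T n) _).
    by move=> n /negP.
  move=> m xm; exists m.+1 => n mn /TH /negP; apply.
  by apply: (H_mono _ _ mn) => /=; rewrite inE xm orbT.
have ex_t n : exists x, x \in T n by have [[]] := trP (H n).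
have [t tP] := choice ex_t.
exists t => X.
have : eventually (fun n => forall x, x \in X -> x \notin T n).
  by apply: eventually_fset => x _; apply: T_fin.
apply: eventually_impl => n Xn.
(* Transversality at the union of [X] and [H n]: [T n] misses both sets, so [x] lies in the
   component chosen there, hence in [g X]. *)
have [cT _ /(_ _ (fsubsetUr X (H n)))[x [xT]]] := trP (H n).
rewrite inE => -[/orP[/Xn|xH]|gx]; first by rewrite xT.
  by have := TH n x xT; rewrite xH.
apply: (strongly_connected_sub_direction (v := x) cT _ xT _ (tP n)).
  by move=> z zT; apply/negP => /Xn /negP; apply.
exact: g_anti (fsubsetUl X (H n)) _ gx.
Qed.

Lemma converging_sequence :
  exists t : nat -> D, forall X, eventually (fun n => g X (t n)).
Proof.
have [[Z /converging_sequence_escapable]//|nesc] :=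
  pselect (exists Z, escapable Z).
by apply: converging_sequence_inescapable => Z escZ; apply: nesc; exists Z.
Qed.

Lemma ray_of_direction :
  exists R, ray R /\ forall X, has_tail_in R (g X).
Proof.
have [t t_cv] := converging_sequence.
have [N NP] := choice t_cv.
(* An index of at least [N Z] puts the vertex in [g Z]; an index of at least [k] puts it in any
   given [g X] for large [k]. *)
pose s k Z := t (maxn k (N Z)).
have sP k Z : g Z (s k Z) by apply: NP; apply: leq_maxr.
have ex_hull (a : {fset D} * D * D) : exists T, g a.1.1 a.1.2 -> g a.1.1 a.2 ->
    [/\ strongly_connected [set` T], [set` T] `<=` g a.1.1,
        a.1.2 \in T & a.2 \in T].
  move: a => [[Z x] y] /=.
  have [gx|//] := pselect (g Z x); last by exists Z.
  have [gy|//] := pselect (g Z y); last by exists Z.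
  have [_ cZ _] := g_component Z.
  by have [T TP] := strongly_connected_fset2 cZ gx gy; exists T.
have [hull hullP] := choice ex_hull.
(* The link P k joins s k (Z k) to s k.+1 (Z k.+1) inside g (Z k), where
   Z k.+1 has to be known first; hence P k is only put into Z k.+2. *)
pose c := fix c k : {fset D} * {fset D} := if k is k'.+1
  then let: (Z, Q) := c k' in
       ((Z `|` Q)%fset, hull (Z, s k' Z, s k'.+1 (Z `|` Q)%fset))
  else (fset0, fset0).
pose Z k := (c k).1; pose P k := (c k.+1).2; pose r k := s k (Z k).
have ZS k : Z k.+1 = ((c k).1 `|` (c k).2)%fset by rewrite /Z /=; case: (c k).
have PE k : P k = hull (Z k, r k, r k.+1).
  by rewrite /r ZS /P /Z /=; case: (c k).
have ZZS k : (Z k `<=` Z k.+1)%fset by rewrite ZS fsubsetUl.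
have PP k : [/\ strongly_connected [set` P k], [set` P k] `<=` g (Z k),
    r k \in P k & r k.+1 \in P k].
  rewrite PE; apply: (hullP (Z k, r k, r k.+1)); first exact: sP.
  exact: g_anti (ZZS k) _ (sP _ _).
have Z_mono m n : m <= n -> {subset Z m <= Z n}.
  move=> /subnKC <-; elim: (n - m) => [|k IH] x xm; rewrite ?addn0 ?addnS //.
  by apply: (fsubsetP (ZZS _)); apply: IH.
have P_fin v : eventually (fun k => v \notin P k).
  apply: eventually_impl (@eventually_not (fun n => v \in P n) _).
    by move=> n /negP.
  (* [P m] is included in [Z n] from [n = m.+2] on, while [P n] lies in [g (Z n)] and so misses
     [Z n]. *)
  move=> m vm; exists m.+2 => n mn vn.
  have [_ Pg _ _] := PP n.
  have /negP := strong_component_notin (g_component _) (Pg _ vn).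
  by apply; apply: (Z_mono _ _ mn); rewrite ZS inE [v \in (c m.+1).2]vm orbT.
have [||||R [rR tR]] := @ray_of_chain _ P r;
  [by move=> k; case: (PP k)..|exact: P_fin|].
exists R; split=> // X; apply: tR.
have : eventually (fun n => forall x, x \in X -> x \notin P n).
  by apply: eventually_fset => x _; apply: P_fin.
move=> /(eventually_and (eventually_ge (N X))).
apply: eventually_impl => n [Nn Xn]; have [cP _ rP _] := PP n.
apply: (strongly_connected_sub_direction (v := r n)) => //.
  by move=> z zT; apply/negP => /Xn /negP; apply.
by apply: NP; rewrite leq_max Nn.
Qed.

(** For the class [w] of the ray, both components contain a tail of that ray, so they coincide. *)
Lemma end_of_direction : exists w, is_end w /\ forall X, comp_end X w = g X.
Proof.
have [R [rR tR]] := ray_of_direction.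
have solR : solid R by split=> // X; exists (g X).
have RR : ray_equiv R R by move=> X; exists (g X).
pose w := [set R' | solid R' /\ ray_equiv R R'].
have endw : is_end w by exists R.
exists w; split=> // X; have [cX /(_ R (conj solR RR))] := comp_endP X endw.
move=> /(eventually_and (tR X))[n /(_ n (leqnn n))[gn wn]].
exact: strong_component_uniq cX (g_component X) wn gn.
Qed.

End VertexDirections.

(** * Limit edges as pairs of limit points *)

Section Blocks.
Variable D : digraph.
Implicit Types (X Y : {fset D}) (A B C : set D) (u v : D)
  (l : limit_pair D) (f : {fset D} -> part D).

Definition block X v : set D := if v \in X then [set v] else comp_vertex X v.

Definition is_block X A := exists v, A = block X v.

Lemma block_self X v : block X v v.
Proof. by rewrite /block; case: ifPn => // /comp_vertexP[]. Qed.

Lemma strong_component_block X C v :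
  strong_component X C -> C v -> C = block X v.
Proof.
move=> cC Cv; have vX := strong_component_notin cC Cv.
have [cX vv] := comp_vertexP vX.
by rewrite /block (negbTE vX); apply: strong_component_uniq cC cX Cv vv.
Qed.

Lemma is_blockP X A v : is_block X A -> A v -> A = block X v.
Proof.
move=> [u ->]; rewrite {1}/block; case: ifPn => [uX ->//|uX uv].
have [cX _] := comp_vertexP uX.
by rewrite -(strong_component_block cX uv) /block (negbTE uX).
Qed.

Lemma is_block_uniq X A B v :
  is_block X A -> is_block X B -> A v -> B v -> A = B.
Proof. by move=> bA bB /(is_blockP bA)-> /(is_blockP bB)->. Qed.

Lemma is_block_component X C : strong_component X C -> is_block X C.
Proof.
move=> cC; have [v Cv] := strong_component_neq0 cC.
by exists v; apply: strong_component_block.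
Qed.

Lemma is_block_set1 X v : v \in X -> is_block X [set v].
Proof. by move=> vX; exists v; rewrite /block vX. Qed.

Lemma blockS X Y v : (X `<=` Y)%fset -> block Y v `<=` block X v.
Proof.
move=> XY; rewrite {1}/block; case: ifPn => [_ _ ->|vY].
  exact: block_self.
have [cY Yv] := comp_vertexP vY.
have vX : v \notin X by apply: contra vY; apply: (fsubsetP XY).
have [cX Xv] := comp_vertexP vX.
rewrite /block (negbTE vX).
apply: (strongly_connected_sub_component (v := v) cX) => //; first by case: cY.
by move=> x /(strong_component_notin cY); apply: contra; apply: (fsubsetP XY).
Qed.

Lemma is_blockS X Y A B v : (X `<=` Y)%fset -> is_block X A -> is_block Y B ->
  A v -> B v -> B `<=` A.
Proof.
by move=> XY bA bB /(is_blockP bA)-> /(is_blockP bB)->; apply: blockS.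
Qed.

(** * Parts as ordered pairs of blocks *)

Definition join_blocks A B : part D :=
  if `[< A = B >] then Component A else Bundle (edges_between A B).

(** Blocks are disjoint, so the ends of a single edge identify both of them. *)
Lemma edges_between_inj X A B A' B' :
  is_block X A -> is_block X B -> is_block X A' -> is_block X B' ->
  edges_between A B !=set0 -> edges_between A B = edges_between A' B' ->
  A = A' /\ B = B'.
Proof.
move=> bA bB bA' bB' [[u v] uvAB] E; move: (uvAB); rewrite E.
case: uvAB => _ [/= Au Bv] [_ [/= A'u B'v]].
by split; [apply: is_block_uniq bA bA' Au A'u
          | apply: is_block_uniq bB bB' Bv B'v].
Qed.

Lemma join_blocks_inj X A B A' B' :
  is_block X A -> is_block X B -> is_block X A' -> is_block X B' ->
  (A <> B -> edges_between A B !=set0) ->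
  join_blocks A B = join_blocks A' B' -> A = A' /\ B = B'.
Proof.
move=> bA bB bA' bB' nAB; rewrite /join_blocks.
case: asboolP => [<-|/nAB AB0]; case: asboolP => [<-|_].
- by case=> ->.
- by [].
- by [].
- by case=> /(edges_between_inj bA bB bA' bB' AB0).
Qed.

Lemma part_sub_join_blocks X A B A' B' :
  is_block X A -> is_block X B -> A' `<=` A -> B' `<=` B -> A' !=set0 ->
  part_sub (join_blocks A' B') (join_blocks A B).
Proof.
move=> bA bB AA BB [v A'v]; rewrite /join_blocks.
have EE : edges_between A' B' `<=` edges_between A B.
  by move=> [x y] [exy [/= /AA Ax /BB By]].
case: asboolP => [A'B'|_]; last first.
  split=> [x []|/=]; case: asboolP => [AB|_] //=.
  by rewrite -AB in EE.
(* A common vertex of the smaller blocks forces the larger ones to agree. *)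
have AB : A = B.
  by apply: is_block_uniq bA bB (AA _ A'v) _; apply: BB; rewrite -A'B'.
by rewrite asboolT //; split=> //=; rewrite -A'B' -AB in EE.
Qed.

Lemma join_blocks_sub X Y A B A' B' : (X `<=` Y)%fset ->
  is_block X A -> is_block X B -> is_block Y A' -> is_block Y B' ->
  (A' <> B' -> edges_between A' B' !=set0) ->
  part_sub (join_blocks A' B') (join_blocks A B) -> A' `<=` A /\ B' `<=` B.
Proof.
move=> XY bA bB bA' bB' nA'B'; rewrite /join_blocks /part_sub.
case: (asboolP (A' = B')) => [<-|/nA'B'[[u v] uvE] [_ /= /(_ _ uvE) uvF]].
  (* A component cannot lie in a bundle: blocks are non-empty and a bundle has no vertices. *)
  case: asboolP => [<- []//|_ /= [A'0 _]].
  by have [v A'E] := bA'; have := A'0 v; rewrite A'E => /(_ (block_self _ _)).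
have [_ [/= A'u B'v]] := uvE.
have [Au Bv] : A u /\ B v by case: asboolP uvF => [<-|_] [_ []].
by split; [apply: is_blockS XY bA bA' Au A'u
          | apply: is_blockS XY bB bB' Bv B'v].
Qed.

(** * Ends and vertices as limit points *)

Inductive limit_point := LimitEnd of set (nat -> D) | LimitVertex of D.

Definition is_limit_point p := if p is LimitEnd w then is_end w else True.

Definition point_block X p :=
  match p with LimitEnd w => comp_end X w | LimitVertex v => block X v end.

Lemma is_block_point X p : is_limit_point p -> is_block X (point_block X p).
Proof.
case: p => [w|v] /= pP; last by exists v.
by apply: is_block_component; case: (comp_endP X pP).
Qed.

Lemma comp_endS X Y w : (X `<=` Y)%fset -> is_end w ->
  comp_end Y w `<=` comp_end X w.
Proof.
move=> XY wP; have [cX tX] := comp_endP X wP; have [cY tY] := comp_endP Y wP.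
have [R wR] : w !=set0.
  have [R solR ->] := wP; exists R; split=> // Z.
  by case: solR => _ /(_ Z)[C cC tC]; exists C.
have [n /(_ n (leqnn n))[nX nY]] := eventually_and (tX R wR) (tY R wR).
exact: is_blockS XY (is_block_component cX) (is_block_component cY) nX nY.
Qed.

Lemma point_blockS X Y p : (X `<=` Y)%fset -> is_limit_point p ->
  point_block Y p `<=` point_block X p.
Proof. by case: p => [w|v] XY pP; [apply: comp_endS | apply: blockS]. Qed.

(** A ray of one end has a tail in every component of the other, hence is equivalent to its rays. *)
Lemma end_eq w h : is_end w -> is_end h ->
  (forall X, comp_end X w = comp_end X h) -> w = h.
Proof.
have sub w' h' : is_end w' -> is_end h' ->
    (forall X, comp_end X w' = comp_end X h') -> w' `<=` h'.
  move=> wP hP E R wR.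
  have [R0 [R0ray R0sol] hE] := hP.
  have hR0 : h' R0.
    by rewrite hE; split=> // X; have [C cC tC] := R0sol X; exists C.
  have [R1 _ wE] := wP; move: (wR); rewrite wE => -[solR _].
  rewrite hE; split=> // X; exists (comp_end X h').
  have [cX tX] := comp_endP X hP; split=> //; first exact: tX.
  by rewrite -E; case: (comp_endP X wP) => _; apply.
by move=> wP hP E; apply/seteqP; split; apply: sub.
Qed.

Lemma comp_end_neq_block X w v :
  is_end w -> v \in X -> comp_end X w <> block X v.
Proof.
move=> wP vX E; have [cX _] := comp_endP X wP.
have := block_self X v; rewrite -E => /(strong_component_notin cX).
by rewrite vX.
Qed.

(** A vertex is told apart from any other point once it lies in [X]: its block is then a singleton
    that no end chooses. *)
Lemma point_block_inj p q : is_limit_point p -> is_limit_point q ->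
  (forall X, point_block X p = point_block X q) -> p = q.
Proof.
case: p q => [w|v] [h|u] /= pP qP E.
- by congr LimitEnd; apply: end_eq.
- by case: (@comp_end_neq_block [fset u]%fset w u pP); rewrite ?inE.
- by case: (@comp_end_neq_block [fset v]%fset h v qP); rewrite ?inE.
- have := block_self [fset u; v]%fset v; rewrite E /block !inE eqxx /=.
  by move=> ->.
Qed.

(** * Limit edges by source and target *)

Definition source (l : limit_pair D) : limit_point :=
  match l with
  | EndEnd w _ => LimitEnd w | VertexEnd v _ => LimitVertex v
  | EndVertex w _ => LimitEnd w
  end.

Definition target (l : limit_pair D) : limit_point :=
  match l with
  | EndEnd _ h => LimitEnd h | VertexEnd _ w => LimitEnd w
  | EndVertex _ v => LimitVertex v
  end.

Lemma limit_pair_eq l l' :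
  source l = source l' -> target l = target l' -> l = l'.
Proof.
by case: l l' => [? ?|? ?|? ?] [? ?|? ?|? ?] //= [->] [->].
Qed.

Lemma comp_end_block X w v :
  is_end w -> comp_end X w v <-> block X v = comp_end X w.
Proof.
move=> wP; split=> [wv|<-]; last exact: block_self.
by have [cX _] := comp_endP X wP; rewrite (strong_component_block cX wv).
Qed.

(** A vertex lies in the component of an end exactly when that component is its block, so the three
    cases become one. *)
Lemma limit_edge_directionE l X :
  is_limit_point (source l) -> is_limit_point (target l) ->
  limit_edge_direction l X =
  join_blocks (point_block X (source l)) (point_block X (target l)).
Proof.
case: l => [w h|v w|w v] //= wP hP; rewrite /join_blocks.
- case: asboolP => [/(comp_end_block _ _ hP) E|nv]; first by rewrite asboolT E.
  rewrite asboolF => [|/(comp_end_block _ _ hP)//].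
  by rewrite /block; case: ifP.
- case: asboolP => [/(comp_end_block _ _ wP) E|nv]; first by rewrite asboolT ?E.
  rewrite asboolF => [|/esym/(comp_end_block _ _ wP)//].
  by rewrite /block; case: ifP.
Qed.

Definition linked p q := forall X, point_block X p <> point_block X q ->
  edges_between (point_block X p) (point_block X q) !=set0.

(* For a vertex v, the edge at [v |` X] starts in v itself, not just in the
   component of v. *)
Lemma limit_edgeE l : limit_edge l <->
  [/\ is_limit_point (source l), is_limit_point (target l),
      source l <> target l & linked (source l) (target l)].
Proof.
have avoid X v w : is_end w -> ~ comp_end (v |` X)%fset w v.
  move=> wP; have [cX _] := comp_endP (v |` X)%fset wP.
  by move=> /(strong_component_notin cX); rewrite !inE eqxx.
have blockU X v : block (v |` X)%fset v = [set v] by rewrite /block !inE eqxx.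
case: l => [w h|v w|w v]; rewrite /linked /limit_edge /=.
- split=> [[wP hP wh E]|[wP hP wh E]]; split=> //; first by case.
  by move=> wh'; apply: wh; rewrite wh'.
- split=> [[wP E]|[_ wP _ E]]; split=> // X nX.
    have [|[x y] [xy [/= xv wy]]] := E X.
      by move=> /(comp_end_block _ _ wP).
    by exists (x, y); split=> //; split=> //=;
      rewrite ?xv ?yv; apply: block_self.
  have [|[x y] [xy [/=]]] := E (v |` X)%fset.
    by move=> /(comp_end_block _ _ wP); apply: avoid.
  rewrite blockU => xv wy; exists (x, y); split=> //; split=> //=.
  by apply: comp_endS wy => //; apply: fsubsetU1.
- split=> [[wP E]|[wP _ _ E]]; split=> // X nX.
    have [|[x y] [xy [/= wx yv]]] := E X.
      by move=> /(comp_end_block _ _ wP) /esym.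
    by exists (x, y); split=> //; split=> //=;
      rewrite ?xv ?yv; apply: block_self.
  have [|[x y] [xy [/=]]] := E (v |` X)%fset.
    by move=> /esym /(comp_end_block _ _ wP); apply: avoid.
  rewrite blockU => wx yv; exists (x, y); split=> //; split=> //=.
  by apply: comp_endS wx => //; apply: fsubsetU1.
Qed.

(** Inclusions hold since the blocks of a point shrink; a bundle occurs since some [X] separates the
    two distinct points. *)
Lemma edge_direction_limit_edge l : limit_edge l ->
  edge_direction (limit_edge_direction l).
Proof.
move=> /limit_edgeE[sP tP st E].
have point0 X p : is_limit_point p -> point_block X p !=set0.
  by move=> /(is_block_point X)[v ->]; exists v; apply: block_self.
(* With an end among the two points, equal blocks form a component and never a singleton of [X]. *)
have some_end : exists w,
    is_end w /\ (source l = LimitEnd w \/ target l = LimitEnd w).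
  by case: l sP tP {st E} => [w h|v w|w v] /= wP hP; exists w;
    split=> //; tauto.
have src_or_tgt X : strong_component X (point_block X (source l)) \/
    strong_component X (point_block X (target l)).
  have [w [wP [->|->]]] := some_end; [left|right]; by case: (comp_endP X wP).
split; [split=> [X|X Y XY]|].
- rewrite limit_edge_directionE // /join_blocks.
  case: asboolP => [stE|stN] /=; first by case: (src_or_tgt X); rewrite ?stE.
  split; first exact: E.
  case: l sP tP {st E some_end} stN src_or_tgt => [w h|v w|w v] /= wP hP stN _.
  + apply: Or31; exists (comp_end X w), (comp_end X h).
    by split=> //; [case: (comp_endP X wP) | case: (comp_endP X hP)].
  + have [cX _] := comp_endP X hP.
    move: stN; rewrite /block; case: ifPn => [vX _|vX vw].
      by apply: Or32; exists v, (comp_end X w).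
    apply: Or31; exists (comp_vertex X v), (comp_end X w).
    by split=> //; case: (comp_vertexP vX).
  + have [cX _] := comp_endP X wP.
    move: stN; rewrite /block; case: ifPn => [vX _|vX vw].
      by apply: Or33; exists v, (comp_end X w).
    apply: Or31; exists (comp_end X w), (comp_vertex X v).
    by split=> //; case: (comp_vertexP vX).
- rewrite !limit_edge_directionE //.
  apply: (part_sub_join_blocks (X := X)); do ?exact: is_block_point.
  + exact: point_blockS. + exact: point_blockS. + exact: point0.
- have [X stX] : exists X, point_block X (source l) <> point_block X (target l).
    apply: contrapT => nX; apply: st; apply: point_block_inj => // X.
    by apply: contrapT => stX; apply: nX; exists X.
  exists X, (edges_between (point_block X (source l))
    (point_block X (target l))).
  by rewrite limit_edge_directionE // /join_blocks asboolF.
Qed.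

Lemma limit_edge_direction_inj l l' : limit_edge l -> limit_edge l' ->
  limit_edge_direction l = limit_edge_direction l' -> l = l'.
Proof.
move=> /limit_edgeE[sP tP _ E] /limit_edgeE[sP' tP' _ E'] ll'.
have blocksE X : point_block X (source l) = point_block X (source l') /\
    point_block X (target l) = point_block X (target l').
  have := congr1 (@^~ X) ll'; rewrite !limit_edge_directionE //.
  by apply: join_blocks_inj (E X); apply: is_block_point.
apply: limit_pair_eq; apply: point_block_inj => // X.
- by case: (blocksE X).
- by case: (blocksE X).
Qed.

(** * Recovering limit points from an edge-direction *)

Lemma point_of_blocks (A : {fset D} -> set D) :
  (forall X, is_block X (A X)) ->
  (forall X Y, (X `<=` Y)%fset -> A Y `<=` A X) ->
  exists p, is_limit_point p /\ forall X, A X = point_block X p.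
Proof.
move=> bA A_anti.
have [[X [v [vX AX]]]|nv] := pselect (exists X v, v \in X /\ A X = [set v]).
  exists (LimitVertex v); split=> // Y /=; apply: is_blockP => //.
  (* The block at the union lies in both [A Y] and [A X], the latter being the singleton of [v]; so
     [v] is in [A Y]. *)
  have [u AU] := bA (Y `|` X)%fset.
  have Au : A (Y `|` X)%fset u by rewrite AU; apply: block_self.
  have := A_anti _ _ (fsubsetUr Y X) _ Au; rewrite AX => <-.
  exact: A_anti (fsubsetUl Y X) _ Au.
have cA X : strong_component X (A X).
  have [v AX] := bA X; move: (AX); rewrite /block; case: ifPn => [vX AX1|vX ->].
    by case: nv; exists X, v.
  by case: (comp_vertexP vX).
have [w [wP wE]] := end_of_direction cA A_anti.
by exists (LimitEnd w); split=> // X /=; rewrite wE.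
Qed.

(** The last clause records that no part comes from two singletons of [X]. *)
Lemma part_of_blocks X q : part_of X q -> exists AB : set D * set D,
  [/\ is_block X AB.1, is_block X AB.2, q = join_blocks AB.1 AB.2,
      AB.1 <> AB.2 -> edges_between AB.1 AB.2 !=set0 &
      strong_component X AB.1 \/ strong_component X AB.2].
Proof.
case: q => [C|F] /= => [cC|[F0]].
  exists (C, C); split=> //=; try exact: is_block_component; last by left.
  by rewrite /join_blocks asboolT.
have neq v C : v \in X -> strong_component X C -> [set v] <> C.
  move=> vX cC vC; have := strong_component_notin cC (v := v).
  by rewrite -vC vX => /(_ erefl).
case=> [[C [C' [cC cC' CC' FE]]]|[v [C [vX cC FE]]]|[v [C [vX cC FE]]]];
  rewrite {}FE in F0 *.
- exists (C, C'); split=> //=; try exact: is_block_component; last by left.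
  by rewrite /join_blocks asboolF.
- exists ([set v], C); split=> //=; last by right.
  + exact: is_block_set1. + exact: is_block_component.
  by rewrite /join_blocks asboolF //; apply: neq.
- exists (C, [set v]); split=> //=; last by left.
  + exact: is_block_component. + exact: is_block_set1.
  by rewrite /join_blocks asboolF // => /esym; apply: neq.
Qed.

(** Both coordinates of the pairs of blocks shrink as [X] grows, so each is given by a limit
    point. *)
Lemma limit_edge_direction_surj f : edge_direction f ->
  exists2 l, limit_edge l & limit_edge_direction l = f.
Proof.
move=> [[fP f_anti] [X0 [F fX0]]].
have [AB ABP] := choice (fun X => part_of_blocks (fP X)).
have AB_anti X Y : (X `<=` Y)%fset ->
    (AB Y).1 `<=` (AB X).1 /\ (AB Y).2 `<=` (AB X).2.
  move=> XY; have [bA bB fX _ _] := ABP X; have [bA' bB' fY EY _] := ABP Y.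
  by apply: (join_blocks_sub XY) => //; rewrite -fX -fY; apply: f_anti.
have [||p [pP pE]] := @point_of_blocks (fun X => (AB X).1).
- by move=> X; case: (ABP X).
- by move=> X Y /AB_anti[].
have [||q [qP qE]] := @point_of_blocks (fun X => (AB X).2).
- by move=> X; case: (ABP X).
- by move=> X Y /AB_anti[].
have [l [lp lq]] : exists l, source l = p /\ target l = q.
  case: p q pP qP pE qE => [w|v] [h|u] /= _ _ pE qE.
  - by exists (EndEnd w h).
  - by exists (EndVertex w u).
  - by exists (VertexEnd v h).
  (* Two vertices are impossible: at the set of both, each block is a singleton and neither is a
     component. *)
  - have [_ _ _ _] := ABP [fset v; u]%fset.
    by rewrite pE qE => -[] cC;
      have := strong_component_notin cC (block_self _ _);
      rewrite !inE eqxx ?orbT.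
subst p q; exists l.
  apply/limit_edgeE; split=> //.
    (* Equal points would make [f X0] a component, but it is a bundle. *)
    move=> st; have [_ _ + _ _] := ABP X0.
    by rewrite fX0 pE qE st /join_blocks asboolT.
  by move=> X; rewrite -pE -qE; case: (ABP X).
by apply/funext => X; rewrite limit_edge_directionE // -pE -qE; case: (ABP X).
Qed.

End Blocks.

Theorem theorem5p3 (D : digraph) (D_infinite : infinite_set [set: D]) :
  set_bij (@limit_edge D) (@edge_direction D) (@limit_edge_direction D).
Proof.
split.
- exact: edge_direction_limit_edge.
- by move=> l l' /set_mem lP /set_mem lP'; apply: limit_edge_direction_inj.
- by move=> f /limit_edge_direction_surj[l lP lf]; exists l.
Qed.
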